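(* For any relatively prime integers $1 \leq p < q$ and for any finite set $A \subset \mathbb{Z}$ one has $$|p \cdot A + q \cdot A| \geq (p+q)|A| - (pq)^{(p+q-3)(p+q)+1}.$$
   Context: For finite sets $A, B$ of real numbers, $A + B = \{a + b : a \in A,\ b \in B\}$ is the sumset, and for $d > 0$, $d \cdot A = \{da : a \in A\}$ is the dilation of $A$ by $d$. $|X|$ denotes the cardinality of a finite set $X$. *)

(* Defs.v *)
From HB Require Import structures.
From mathcomp Require Import all_boot all_order all_algebra finmap.

Set Implicit Arguments.
Unset Strict Implicit.
Unset Printing Implicit Defensive.

Import Order.TTheory GRing.Theory Num.Theory.

Local Open Scope ring_scope.

Definition sumset (R : nzRingType) (A B : {fset R}) : {fset R} :=
  [fset (a + b)%R | a in A, b in B]%fset.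

Definition dilate (R : nzRingType) (d : R) (A : {fset R}) : {fset R} :=
  [fset (d * a)%R | a in A]%fset.

(* Main.v *)
(* Put f(A) = |p.A + q.A| and N = p + q. If A meets every residue class modulo p
   and modulo q, summing |X + Y| >= |X| + |Y| - 1 over the pairs (class modulo q,
   class modulo p) gives f(A) >= N|A| - pq. In general the slope m in an
   estimate f(A) >= m|A| - C, valid for all A, is raised from 3 to N in steps
   of 1/N, each step multiplying C by pq. Normalise A so that it generates Z and
   split it into classes X modulo q, so that f(A) is at least the sum of the
   |p.X + q.A|. A class with at most |A|/N elements gives the gain |A|/N when it
   is removed. Otherwise, if some class X misses a class modulo q^2 inside its
   class modulo q, then p.X + q.A meets a class modulo q^2 that p.X + q.X
   misses, a gain of a full class of A. The remaining sets are, after rescaling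
   each X, fully distributed modulo q; splitting those modulo p, each piece
   yields a gain for the same reason or is fully distributed modulo p and q. *)

Require Import Defs.
From HB Require Import structures.
From mathcomp Require Import all_boot all_order all_algebra finmap.
From mathcomp Require Import ring zify.
From Stdlib Require Import Classical.

Set Implicit Arguments.
Unset Strict Implicit.
Unset Printing Implicit Defensive.

Import Order.TTheory GRing.Theory Num.Theory.

Local Open Scope ring_scope.

(** * Sums of two dilates, affine images and residue classes *)

Definition sd (p q : nat) (A B : {fset int}) : {fset int} :=
  sumset (dilate p%:Z A) (dilate q%:Z B).

Definition affine (r g : int) (A : {fset int}) : {fset int} :=
  [fset (r + g * a)%R | a in A]%fset.

Definition cls (m : nat) (i : int) (A : {fset int}) : {fset int} :=
  [fset a in A | (m%:Z %| (a - i)%R)%Z]%fset.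

Definition fully_distributed (m : nat) (A : {fset int}) : Prop :=
  forall t : int, exists2 a, a \in A & (m%:Z %| a - t)%Z.

(** The subgroup spanned by [A] is all of the integers, with subgroups given as predicates closed
    under subtraction. Having 0 in [A] fixes the translation, so that the differences of elements of
    [A] span the same subgroup. *)
Definition generating (A : {fset int}) : Prop :=
  0 \in A /\
  forall D : int -> Prop, D 0 -> (forall x y : int, D x -> D y -> D (x - y)) ->
    (forall a : int, a \in A -> D a) -> D 1.

Lemma sumsetP (A B : {fset int}) x :
  reflect (exists2 a, a \in A & exists2 b, b \in B & x = a + b)
          (x \in sumset A B).
Proof. exact: imfset2P. Qed.

Lemma affineP r g (A : {fset int}) x :
  reflect (exists2 a, a \in A & x = r + g * a) (x \in affine r g A).
Proof. exact: imfsetP. Qed.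

Lemma sdP p q A B x :
  reflect (exists2 a, a \in A & exists2 b, b \in B & x = p%:Z * a + q%:Z * b)
          (x \in sd p q A B).
Proof.
apply: (iffP (sumsetP _ _ _)).
  move=> [_ /imfsetP[a aA ->] [_ /imfsetP[b bB ->] ->]].
  by exists a => //; exists b.
move=> [a aA [b bB ->]]; exists (p%:Z * a); first exact: in_imfset.
by exists (q%:Z * b) => //; exact: in_imfset.
Qed.

Lemma mem_sd p q (A B : {fset int}) a b :
  a \in A -> b \in B -> p%:Z * a + q%:Z * b \in sd p q A B.
Proof. by move=> aA bB; apply/sdP; exists a => //; exists b. Qed.

Lemma mem_cls m i A a : (a \in cls m i A) = (a \in A) && (m%:Z %| a - i)%Z.
Proof. by rewrite !inE. Qed.

Lemma cls_sub m i A : (cls m i A `<=` A)%fset.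
Proof. by apply/fsubsetP=> a; rewrite mem_cls => /andP[]. Qed.

Lemma sdC p q A B : sd p q A B = sd q p B A.
Proof.
by apply/fsetP=> x; apply/sdP/sdP => -[a aA [b bB ->]];
  exists b => //; exists a => //; rewrite addrC.
Qed.

Lemma sdS p q A A' B B' :
  (A `<=` A')%fset -> (B `<=` B')%fset -> (sd p q A B `<=` sd p q A' B')%fset.
Proof.
move=> /fsubsetP sA /fsubsetP sB; apply/fsubsetP=> _ /sdP[a aA [b bB ->]].
by apply: mem_sd; [exact: sA|exact: sB].
Qed.

Lemma card_affine r g A : g != 0 -> #|` affine r g A| = #|` A|.
Proof.
move=> g0; rewrite card_imfset //= => a b /addrI; exact: mulfI.
Qed.

Lemma card_dilate d (A : {fset int}) : d != 0 -> #|` dilate d A| = #|` A|.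
Proof. by move=> d0; rewrite card_imfset //= => a b; exact: mulfI. Qed.

Lemma sd_affine p q r s g A B :
  sd p q (affine r g A) (affine s g B)
  = affine (p%:Z * r + q%:Z * s) g (sd p q A B).
Proof.
apply/fsetP=> x; apply/sdP/affineP.
  move=> [_ /affineP[a aA ->] [_ /affineP[b bB ->] ->]].
  by exists (p%:Z * a + q%:Z * b); [exact: mem_sd|ring].
move=> [_ /sdP[a aA [b bB ->]] ->].
exists (r + g * a); first by apply/affineP; exists a.
by exists (s + g * b); [apply/affineP; exists b|ring].
Qed.

Lemma card_sd_affine p q r s g A B : g != 0 ->
  #|` sd p q (affine r g A) (affine s g B)| = #|` sd p q A B|.
Proof. by move=> g0; rewrite sd_affine card_affine. Qed.

(** * Lower bound for the size of a sumset *)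

Lemma exists_max (A : {fset int}) a0 : a0 \in A ->
  exists2 m, m \in A & {in A, forall x, x <= m}.
Proof.
have [s sA] : exists s : seq int, s =i A by exists (enum_fset A).
rewrite -sA; suff: s != [::] -> exists2 m, m \in s & {in s, forall x, x <= m}.
  move=> H a0s; have [|m ms Hm] := H; first by case: s a0s {sA H}.
  by exists m; rewrite -?sA // => x xA; apply: Hm; rewrite sA.
elim: s {sA} => // x [|y s] IH _.
  by exists x; rewrite ?inE // => z; rewrite inE => /eqP->.
have [//|m ms Hm] := IH; case: (leP x m) => xm.
  exists m => [|z]; first by rewrite inE ms orbT.
  by rewrite inE => /orP[/eqP->//|]; exact: Hm.
exists x => [|z]; first by rewrite inE eqxx.
by rewrite inE => /orP[/eqP->//|/Hm zm]; exact: le_trans zm (ltW xm).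
Qed.

Lemma exists_min (A : {fset int}) a0 : a0 \in A ->
  exists2 m, m \in A & {in A, forall x, m <= x}.
Proof.
move=> aA; have [|_ /imfsetP[m mA ->] Hm] :=
    @exists_max [fset (- x)%R | x in A]%fset (- a0).
  exact: in_imfset.
exists m => // x xA; rewrite -lerN2; apply: Hm; exact: in_imfset.
Qed.

(* The translates [max A + B] and [A + min B] share a single element. *)
Lemma card_sumset_ge (A B : {fset int}) a0 b0 : a0 \in A -> b0 \in B ->
  (#|` A| + #|` B| <= #|` sumset A B| + 1)%N.
Proof.
move=> aA bB; have [m mA Hm] := exists_max aA; have [n nB Hn] := exists_min bB.
pose U := affine m 1 B; pose V := affine n 1 A.
rewrite -(card_affine m B (oner_neq0 _)) -(card_affine n A (oner_neq0 _)).
rewrite addnC -/U -/V -cardfsUI; apply: leq_add.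
  apply/fsubset_leq_card/fsubsetP=> x; rewrite inE => /orP[] /affineP[c cI ->];
    apply/sumsetP.
    by exists m => //; exists c => //; rewrite mul1r.
  by exists c => //; exists n => //; rewrite mul1r addrC.
rewrite -(cardfs1 (m + n)); apply/fsubset_leq_card/fsubsetP=> x; rewrite !inE.
case/andP=> /affineP[b /Hn nb ->] /affineP[a /Hm am]; rewrite !mul1r => E.
by apply/eqP; lia.
Qed.

Lemma card_sd_ge p q (A B : {fset int}) a0 b0 :
  (0 < p)%N -> (0 < q)%N -> a0 \in A -> b0 \in B ->
  (#|` A| + #|` B| <= #|` sd p q A B| + 1)%N.
Proof.
move=> p0 q0 aA bB.
rewrite -(@card_dilate p%:Z A) -?(@card_dilate q%:Z B); try lia.
by apply: (@card_sumset_ge _ _ (p%:Z * a0) (q%:Z * b0)); exact: in_imfset.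
Qed.

(** * Counting by residue classes *)

Lemma leq_sum_card_disjoint m (F : 'I_m -> {fset int}) (Z : {fset int}) :
  (forall i, F i `<=` Z)%fset ->
  (forall i j x, x \in F i -> x \in F j -> i = j) ->
  (\sum_(i < m) #|` F i| <= #|` Z|)%N.
Proof.
move=> FZ Fd.
have cardE i : #|` F i| = (\sum_(z <- Z) (z \in F i))%N.
  have -> : F i = [fset z in Z | z \in F i]%fset.
    apply/fsetP=> z; rewrite !inE /=; case: (boolP (z \in F i)) => [zF|_].
      by rewrite (fsubsetP (FZ i) z zF).
    by rewrite andbF.
  rewrite card_fset_sum1 big_fset /= big_mkcond /=; apply: eq_big_seq => z zZ.
  by rewrite !inE /= zZ; case: (z \in F i).
rewrite (eq_bigr _ (fun i _ => cardE i)) exchange_big /= card_fset_sum1.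
apply: leq_sum => z _; case: (pickP (fun i => z \in F i)) => [i zi|noi].
  rewrite (bigD1 i) //= zi big1 // => j ji.
  by case: (boolP (z \in F j)) => // zj; rewrite (Fd _ _ _ zj zi) eqxx in ji.
by rewrite big1 // => i _; rewrite noi.
Qed.

Lemma dvdz_lin (m : nat) (a b x y : int) :
  (m%:Z %| x)%Z -> (m%:Z %| y)%Z -> (m%:Z %| a * x + b * y)%Z.
Proof. by move=> mx my; apply: rpredD; apply: dvdz_mull. Qed.

Lemma dvdz_ord (m : nat) (i j : 'I_m) : (m%:Z %| i%:Z - j%:Z)%Z -> i = j.
Proof.
move=> /dvdzP[k Ek]; apply: val_inj => /=; have := ltn_ord i; have := ltn_ord j.
move: Ek; case: (ltrgtP k 0) => [k0|k0|->] /=; nia.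
Qed.

Lemma exists_residue (m : nat) (t : int) : (0 < m)%N ->
  exists i : 'I_m, (m%:Z %| t - i%:Z)%Z.
Proof.
move=> m0; have tm : (absz (t %% m)%Z < m)%N by lia.
exists (Ordinal tm); apply/dvdzP; exists (t %/ m)%Z => /=; lia.
Qed.

Lemma card_cls m (A : {fset int}) : (0 < m)%N ->
  #|` A| = (\sum_(i < m) #|` cls m i%:Z A|)%N.
Proof.
move=> m0; apply/eqP; rewrite eqn_leq; apply/andP; split; last first.
  apply: leq_sum_card_disjoint => [i|i j x]; first exact: cls_sub.
  rewrite !mem_cls => /andP[_ xi] /andP[_ xj]; apply: dvdz_ord.
  have -> : i%:Z - j%:Z = (- 1) * (x - i%:Z) + 1 * (x - j%:Z) by ring.
  exact: dvdz_lin.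
have -> : (\sum_(i < m) #|` cls m i%:Z A|
  = \sum_(a <- A) \sum_(i < m) ((m%:Z %| (a - i%:Z)%R)%Z))%N.
  rewrite exchange_big /=; apply: eq_bigr => i _.
  rewrite card_fset_sum1 big_fset /= big_mkcond /=; apply: eq_big_seq => a aA.
  by case: (_ %| _)%Z.
rewrite card_fset_sum1; apply: leq_sum => a _.
by have [i ai] := exists_residue a m0; rewrite (bigD1 i) //= ai.
Qed.

Lemma coprime_inv (p q : nat) : coprime p q ->
  exists u : int, (q%:Z %| u * p%:Z - 1)%Z.
Proof.
move=> co; have /coprimezP[[u v] /= E] : coprimez p%:Z q%:Z by [].
by exists u; apply/dvdzP; exists (- v); move: E => <-; ring.
Qed.

Lemma dvdz_cancel (p q : nat) (x : int) : coprime p q ->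
  (q%:Z %| p%:Z * x)%Z -> (q%:Z %| x)%Z.
Proof.
move=> co; rewrite Gauss_dvdzr // coprimez_sym //.
Qed.

(** Modulo [q] the element [p * a + q * b] is [p * a], and [p] is invertible, so an element of the
    sum determines the class of [a]: the summands are disjoint. *)
Lemma leq_sum_sd_cls p q A B : (0 < q)%N -> coprime p q ->
  (\sum_(i < q) #|` sd p q (cls q i%:Z A) B| <= #|` sd p q A B|)%N.
Proof.
move=> q0 co; apply: leq_sum_card_disjoint => [i|i j x].
  by apply: sdS; [exact: cls_sub|].
move=> /sdP[a ai [b bB xab]] /sdP[c cj [d dB xcd]].
move: ai cj; rewrite !mem_cls => /andP[_ ai] /andP[_ cj].
apply: dvdz_ord; apply: (dvdz_cancel co).
have E : p%:Z * (a - c) = q%:Z * (d - b) by lia.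
have -> : p%:Z * (i%:Z - j%:Z)
  = 1 * (q%:Z * (d - b)) + 1 * (- p%:Z * (a - i%:Z) + p%:Z * (c - j%:Z)).
  by rewrite -E; ring.
by apply: dvdz_lin; [exact: dvdz_mulr|exact: dvdz_lin].
Qed.

Lemma cls_affine m i A : (0 < m)%N ->
  exists X, cls m i A = affine i m%:Z X.
Proof.
move=> m0; exists [fset ((a - i)%R %/ m)%Z | a in cls m i A]%fset.
apply/fsetP=> x; apply/idP/affineP => [xA|[_ /imfsetP[a aA ->] ->]].
  exists ((x - i) %/ m)%Z; first exact: in_imfset.
  by move: xA; rewrite mem_cls => /andP[_ xi]; rewrite mulrC divzK //; ring.
have := aA; rewrite [in X in X -> _](mem_cls m i A a) => /andP[_ ai].
by rewrite mulrC divzK // addrC subrK.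
Qed.

(** * Normalisation to a generating set *)

Lemma subgroup_mul (D : int -> Prop) x (n : int) : D 0 ->
  (forall x y : int, D x -> D y -> D (x - y)) -> D x -> D (n * x).
Proof.
move=> D0 DB Dx.
have DN y : D y -> D (- y) by rewrite -[- y]add0r; exact: DB.
have Dn (k : nat) : D (k%:Z * x).
  elim: k => [|k IH]; first by rewrite mul0r.
  have -> : k.+1%:Z * x = k%:Z * x - - x by rewrite intS; ring.
  by apply: DB => //; exact: DN.
by case: n => k //; rewrite NegzE mulNr; apply/DN/Dn.
Qed.

Lemma exists_gcd (s : seq int) : exists2 g : int,
  (forall a : int, a \in s -> (g %| a)%Z) &
  forall D : int -> Prop, D 0 -> (forall x y : int, D x -> D y -> D (x - y)) ->
    (forall a : int, a \in s -> D a) -> D g.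
Proof.
elim: s => [|x s [g gs Dg]]; first by exists 0.
have [u [v E]] := Bezoutz x g; exists (gcdz x g).
  move=> a; rewrite inE => /orP[/eqP->|/gs]; first exact: dvdz_gcdl.
  exact/dvdz_trans/dvdz_gcdr.
move=> D D0 DB Ds; rewrite -E.
have DN y : D y -> D (- y) by rewrite -[- y]add0r; exact: DB.
rewrite -[v * g]opprK; apply: (DB); last apply: DN; apply: subgroup_mul => //.
  by apply: Ds; rewrite inE eqxx.
by apply: Dg => // a aS; apply: Ds; rewrite inE aS orbT.
Qed.

(** Translate by an element of [A] and divide by the gcd of the differences, which is nonzero
    because [A] has two elements. *)
Lemma exists_generating (A : {fset int}) : (1 < #|` A|)%N ->
  exists r g B, [/\ g != 0, A = affine r g B & generating B].
Proof.
move=> A1; have /fset0Pn[r rA] : A != fset0 by rewrite -cardfs_gt0 ltnW.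
have [g gA Dg] := exists_gcd [seq a - r | a <- A].
have gr a : a \in A -> (g %| a - r)%Z.
  by move=> aA; apply: gA; apply: map_f.
have g0 : g != 0.
  apply: contraTneq A1 => g0; rewrite -leqNgt -(cardfs1 r).
  apply/fsubset_leq_card/fsubsetP => a /gr; rewrite g0 dvd0z subr_eq0 inE //.
pose B := [fset ((a - r)%R %/ g)%Z | a in A]%fset.
have BP a : a \in A -> ((a - r) %/ g)%Z \in B by move=> aA; exact: in_imfset.
exists r, g, B; split=> //.
  apply/fsetP=> x; apply/idP/affineP => [xA|[_ /imfsetP[a aA ->] ->]].
    by exists ((x - r) %/ g)%Z; [exact: BP|rewrite mulrC divzK ?gr //; ring].
  by rewrite mulrC divzK ?gr // addrC subrK.
split=> [|D D0 DB DA]; first by rewrite -(div0z g) -(subrr r); exact: BP.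
(* Minimality of [g] applied to the subgroup [g * D] puts [g] in [g * D], hence 1 in [D]. *)
have [||_ /mapP[a aA ->]|d Dd] :=
  Dg (fun x => exists2 d, D d & x = g * d).
- by exists 0; rewrite ?mulr0.
- move=> _ _ [d Dd ->] [e De ->]; exists (d - e); [exact: DB|ring].
- exists ((a - r) %/ g)%Z; first exact/DA/BP.
  by rewrite mulrC divzK ?gr.
by move=> E; have -> : 1 = d by apply: (mulfI g0); rewrite mulr1.
Qed.

(** The image meets the class of [r + 1], which provides an inverse [b] of [g] modulo [q];
    congruences between images can then be divided by [g]. *)
Lemma fully_distributed_affine q r g B :
  fully_distributed q (affine r g B) -> fully_distributed q B.
Proof.
move=> fB t; have [_ /affineP[b bB ->] qb] := fB (r + 1).
have [_ /affineP[c cB ->] qc] := fB (r + g * t).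
exists c => //.
have -> : c - t = b * (r + g * c - (r + g * t)) + (t - c) * (r + g * b - (r + 1)).
  by ring.
exact: dvdz_lin.
Qed.

(* [f(A) >= M / (p + q) * |A| - K / (p + q)], cleared of denominators. *)
Definition good (p q M K : nat) (A : {fset int}) : Prop :=
  (M * #|` A| <= (p + q) * #|` sd p q A A| + K)%N.

(** * Invariance of the estimate and removal of a small class *)

Lemma goodC p q M K A : good p q M K A -> good q p M K A.
Proof. by rewrite /good sdC (addnC p). Qed.

Lemma good_weaken p q M K K' A :
  (K <= K')%N -> good p q M K A -> good p q M K' A.
Proof. by rewrite /good => KK' /leq_trans; apply; rewrite leq_add2l. Qed.

Lemma good_affine p q M K r g A : g != 0 ->
  good p q M K A -> good p q M K (affine r g A).
Proof. by move=> g0; rewrite /good card_affine // card_sd_affine. Qed.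

Lemma leq_card_disjoint2 (U V Z : {fset int}) :
  (U `<=` Z)%fset -> (V `<=` Z)%fset -> (forall x, x \in U -> x \notin V) ->
  (#|` U| + #|` V| <= #|` Z|)%N.
Proof.
move=> UZ VZ UV; rewrite -cardfsUI.
have -> : (U `&` V)%fset = fset0.
  apply/fsetP=> x; rewrite !inE; case: (boolP (x \in U)) => //= /UV.
  by move/negbTE.
by rewrite cardfs0 addn0; apply: fsubset_leq_card; rewrite fsubUset UZ VZ.
Qed.

(* Removing the small class [X] from [A] costs at least
   [|p X + q A| >= |X| + |A| - 1] elements of [p A + q A]. *)
Lemma good_small_class p q M K A i x0 :
  (0 < p)%N -> (0 < q)%N -> coprime p q ->
  (forall B, good p q M K B) -> (M <= (p + q) * (p + q))%N ->
  x0 \in cls q i A -> ((p + q) * #|` cls q i A| <= #|` A|)%N ->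
  good p q M.+1 (K + (p + q)) A.
Proof.
move=> p0 q0 co cl MN x0X; set X := cls q i A => small.
have XA : (X `<=` A)%fset := cls_sub q i A.
have le1 : (#|` X| + #|` A| <= #|` sd p q X A| + 1)%N.
  exact: (card_sd_ge p0 q0 x0X (fsubsetP XA _ x0X)).
have := cl (A `\` X)%fset; rewrite /good cardfsDS // => le2.
have le3 : (#|` sd p q X A| + #|` sd p q (A `\` X)%fset (A `\` X)%fset|
            <= #|` sd p q A A|)%N.
  apply: leq_card_disjoint2; [exact: sdS|by apply: sdS; exact: fsubsetDl|].
  move=> _ /sdP[x xX [a aA ->]]; apply/sdP=> -[b]; rewrite inE => /andP[bX bA].
  move=> [c _ E]; move: bX; rewrite mem_cls bA /= => /negP; apply.
  move: xX; rewrite mem_cls => /andP[_ xi].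
  have -> : b - i = 1 * (b - x) + 1 * (x - i) by ring.
  apply: dvdz_lin => //; apply: (dvdz_cancel co).
  by apply/dvdzP; exists (a - c); lia.
have := fsubset_leq_card XA.
move: le1 le2 le3 small MN; rewrite /good.
move: #|` A| #|` X| #|` sd p q X A| #|` sd p q A A| => a x s f.
have : (0 < p + q)%N by lia.
move: #|` sd _ _ _ _| (p + q)%N => f' [//|N] _ le1 le2 le3 small MN xa.
(* With [N.+1] in place of [p + q], the loss [M * x] is at most [N * (N.+1 * x) + N.+1 * x], hence
   at most [N * a + N.+1 * x]. Out of the gain [N.+1 * (x + a)] one copy of [a] remains. *)
have h1 : (M * x <= N.+1 * (N.+1 * x))%N by rewrite mulnA leq_mul2r MN orbT.
have h2 : (N * (N.+1 * x) <= N * a)%N by rewrite leq_mul2l small orbT.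
rewrite mulnBr in le2.
have h3 : (N.+1 * (x + a) <= N.+1 * (s + 1))%N by rewrite leq_mul2l le1 orbT.
have h4 : (N.+1 * (s + f') <= N.+1 * f)%N by rewrite leq_mul2l le3 orbT.
nia.
Qed.

(** * Each class is fully distributed or yields a gain *)

Lemma fully_distributed_of_closed p q A X i x0 : (0 < q)%N ->
  coprime p q -> generating A -> x0 \in X ->
  (forall x a, x \in X -> a \in A ->
     exists2 x', x' \in X & (q%:Z %| p%:Z * x' + i - (p%:Z * x + a))%Z) ->
  fully_distributed q X.
Proof.
move=> q0 co [A0 genA] x0X closedX; have [u qu] := coprime_inv co.
pose P t := exists2 x, x \in X & (q%:Z %| x - t)%Z.
have P_congr t t' : (q%:Z %| t - t')%Z -> P t -> P t'.
  move=> tt' [x xX xt]; exists x => //.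
  have -> : x - t' = 1 * (x - t) + 1 * (t - t') by ring.
  exact: dvdz_lin.
(* As [u] inverts [p], the closure hypothesis says that the residues of [X] are stable under the
   shift by [u * (a - i)]. *)
have fwd a t : a \in A -> P t -> P (t + u * (a - i)).
  move=> aA [x xX xt]; have [x' x'X xx'] := closedX x a xX aA; exists x' => //.
  have -> : x' - (t + u * (a - i)) =
    1 * (u * (p%:Z * x' + i - (p%:Z * x + a)) + 1 * (x - t))
    + (x - x') * (u * p%:Z - 1) by ring.
  apply: dvdz_lin => //; exact: dvdz_lin.
have fwdn a t (n : nat) : a \in A -> P t -> P (t + n%:Z * (u * (a - i))).
  move=> aA Pt; elim: n => [|n IH]; first by rewrite mul0r addr0.
  have -> : t + n.+1%:Z * (u * (a - i))
    = (t + n%:Z * (u * (a - i))) + u * (a - i) by rewrite intS; ring.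
  exact: fwd.
(* [D] is [p] times the stabiliser of [X] modulo [q]. *)
pose D d := forall t, P t <-> P (t + u * d).
have D0 : D 0 by move=> t; rewrite mulr0 addr0.
have DB x y : D x -> D y -> D (x - y).
  move=> Dx Dy t; rewrite Dx (Dy (t + u * (x - y))).
  by have -> : t + u * (x - y) + u * y = t + u * x by ring.
have Dai a : a \in A -> D (a - i).
  move=> aA t; split; first exact: fwd.
  (* A shift is undone modulo [q] by repeating it [q - 1] more times. *)
  move=> /(fwdn a _ q.-1 aA); apply: P_congr; apply/dvdzP; exists (u * (a - i)).
  have -> : q%:Z = q.-1%:Z + 1 by lia.
  by ring.
(* Since 0 is in [A], both [a - i] and [0 - i] lie in [D], and so does [a]. *)
have D1 : D 1.
  apply: genA => // a aA; have -> : a = (a - i) - (0 - i) by ring.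
  by apply: (DB); apply: Dai.
move=> t; have /(_ x0) [+ _] := subgroup_mul (p%:Z * (t - x0)) D0 DB D1.
move=> H; apply: P_congr (H _); last by exists x0; rewrite // subrr dvdz0.
have -> : x0 + u * (p%:Z * (t - x0) * 1) - t
  = 1 * ((t - x0) * (u * p%:Z - 1)) + 0 * (u * p%:Z - 1) by ring.
by apply: dvdz_lin => //; exact: dvdz_mull.
Qed.

(* A class that is not fully distributed modulo [q^2] meets, when summed
   with [A], a residue modulo [q^2] that [p X + q X] misses. *)
Lemma class_gain p q A i X x0 mu : (0 < q)%N -> coprime p q ->
  generating A -> cls q i A = affine i q%:Z X -> x0 \in X ->
  ~ fully_distributed q X ->
  (forall j a, a \in cls q j A -> (mu <= #|` cls q j A|)%N) ->
  (#|` sd p q (cls q i A) (cls q i A)| + mu <= #|` sd p q (cls q i A) A|)%N.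
Proof.
move=> q0 co genA XE x0X nfd mu_le; apply: NNPP => ngain; apply: nfd.
apply: (fully_distributed_of_closed (i := i) q0 co genA x0X) => x a xX aA.
apply: NNPP => nx'; apply: ngain.
have aa : a \in cls q a A by rewrite mem_cls aA subrr dvdz0.
have xc : i + q%:Z * x \in cls q i A by rewrite XE; apply/affineP; exists x.
have qn0 : q%:Z != 0 by lia.
apply: leq_trans (leq_add (leqnn _) (mu_le a a aa)) _.
(* This translate of [q * cls q a A] lies in a single class modulo [q ^ 2]; a common element with
   the first sum would supply the excluded witness [x1]. *)
rewrite -(card_affine (p%:Z * (i + q%:Z * x)) (cls q a A) qn0).
apply: leq_card_disjoint2; first by apply: sdS => //; exact: cls_sub.
  apply/fsubsetP=> _ /affineP[b bA ->]; apply: mem_sd => //.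
  exact: (fsubsetP (cls_sub q a A)).
rewrite {1 2}XE => _ /sdP[_ /affineP[x1 x1X ->] [_ /affineP[x2 x2X ->] ->]].
apply/affineP=> -[b]; rewrite mem_cls => /andP[_ ba] E; apply: nx'.
exists x1 => //; have E' : p%:Z * x1 + i + q%:Z * x2 = p%:Z * x + b.
  by apply: (mulfI qn0); move: E => E; lia.
have -> : p%:Z * x1 + i - (p%:Z * x + a) = 1 * (b - a) + (- x2) * q%:Z.
  by have -> : p%:Z * x1 + i = p%:Z * x + b - q%:Z * x2; [rewrite -E'|]; ring.
exact: dvdz_lin.
Qed.

Lemma good_of_gain p q M K A (i0 : 'I_q) mu : coprime p q ->
  (forall B, good p q M K B) ->
  (#|` sd p q (cls q i0%:Z A) (cls q i0%:Z A)| + mu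
     <= #|` sd p q (cls q i0%:Z A) A|)%N ->
  (#|` A| <= (p + q) * mu)%N -> good p q M.+1 (q * K) A.
Proof.
move=> co cl gain Amu; have q0 : (0 < q)%N by case: q i0 {cl gain Amu co} => [[]|].
have key (i : 'I_q) : (M * #|` cls q i%:Z A| + (i == i0) * #|` A|
    <= (p + q) * #|` sd p q (cls q i%:Z A) A| + K)%N.
  have := cl (cls q i%:Z A); rewrite /good => h1.
  have [->|_] := eqVneq i i0; last first.
    rewrite addn0 (leq_trans h1) // leq_add2r leq_mul2l.
    by rewrite fsubset_leq_card ?orbT // sdS // cls_sub.
  by move: (cl (cls q i0%:Z A)); rewrite /good; nia.
have : (\sum_(i < q) (M * #|` cls q i%:Z A| + (i == i0) * #|` A|)
    <= \sum_(i < q) ((p + q) * #|` sd p q (cls q i%:Z A) A| + K))%N.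
  by apply: leq_sum => i _; exact: key.
rewrite !big_split /= -!big_distrr -big_distrl /= -card_cls // sum_nat_const card_ord.
have -> : (\sum_(i < q) (i == i0) = 1)%N.
  by rewrite (bigD1 i0) //= eqxx big1 // => i /negbTE->.
have : ((p + q) * (\sum_(i < q) #|` sd p q (cls q i%:Z A) A|)
    <= (p + q) * #|` sd p q A A|)%N.
  by rewrite leq_mul2l leq_sum_sd_cls ?orbT.
move=> le1 le2; rewrite /good mulSn addnC -{2}[#|` A|]mul1n (leq_trans le2) //.
by rewrite leq_add2r.
Qed.

Lemma good_or_fully_distributed p q M K A (i : 'I_q) X x0 :
  (0 < p)%N -> (1 < q)%N -> coprime p q ->
  (forall B, good p q M K B) -> (M <= (p + q) * (p + q))%N -> (p + q <= K)%N ->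
  generating A -> cls q i%:Z A = affine i%:Z q%:Z X -> x0 \in X ->
  good p q M.+1 (q * K) A \/ fully_distributed q X.
Proof.
move=> p0 q1 co cl MN NK genA XE x0X; have q0 := ltnW q1.
have KK : (K + (p + q) <= q * K)%N by nia.
have [fdX|nfdX] := classic (fully_distributed q X); first by right.
left; apply: NNPP => ngood.
have large j a : a \in cls q j A -> (#|` A| < (p + q) * #|` cls q j A|)%N.
  move=> aj; rewrite ltnNge; apply/negP => small; apply: ngood.
  exact: good_weaken KK (good_small_class p0 q0 co cl MN aj small).
apply: ngood; apply: (good_of_gain (i0 := i) (mu := (#|` A| %/ (p + q)).+1)) => //.
  apply: class_gain XE x0X nfdX _ => // j a /large.
  by rewrite ltn_divLR ?addn_gt0 ?p0 // mulnC.
rewrite mulnC; apply: ltnW; apply: ltn_ceil; lia.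
Qed.

(** * Fully distributed sets *)

Lemma card_sd_fully_distributed p q (A : {fset int}) : (0 < p)%N -> (0 < q)%N ->
  coprime p q -> fully_distributed p A -> fully_distributed q A ->
  ((p + q) * #|` A| <= #|` sd p q A A| + p * q)%N.
Proof.
move=> p0 q0 co fp fq.
(* The second summand is split modulo [p]; full distribution makes both parts of each pair nonempty,
   and each of the [p] pairs loses 1. *)
have key (i : 'I_q) : (#|` A| + p * #|` cls q i%:Z A|
    <= #|` sd p q (cls q i%:Z A) A| + p)%N.
  rewrite sdC; apply: leq_trans (leq_add (leq_sum_sd_cls _ _ p0 _) (leqnn p)).
    have : (\sum_(j < p) (#|` cls p j%:Z A| + #|` cls q i%:Z A|)
        <= \sum_(j < p) (#|` sd q p (cls p j%:Z A) (cls q i%:Z A)| + 1))%N.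
      apply: leq_sum => j _.
      have [a aA aj] := fp j%:Z; have [b bA bi] := fq i%:Z.
      by apply: (card_sd_ge (a0 := a) (b0 := b)) => //; rewrite mem_cls ?aA ?bA.
    by rewrite !big_split /= -card_cls // !sum_nat_const card_ord muln1.
  by rewrite coprime_sym.
have : (\sum_(i < q) (#|` A| + p * #|` cls q i%:Z A|)
    <= \sum_(i < q) (#|` sd p q (cls q i%:Z A) A| + p))%N.
  by apply: leq_sum => i _; exact: key.
rewrite !big_split /= -big_distrr /= -card_cls // !sum_nat_const card_ord.
have := leq_sum_sd_cls A A q0 co.
move: (\sum_(i < q) _)%N #|` A| => S a; move: #|` _| => f; lia.
Qed.

(** The splitting is now modulo [p], with [p] and [q] exchanged. Unless some piece gives the
    improvement directly, every nonempty piece is, after rescaling, fully distributed modulo both,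
    and [B] attains the full slope [p + q]. *)
Lemma good_fully_distributed p q M K B :
  (0 < p)%N -> (1 < q)%N -> coprime p q ->
  (forall A, good p q M K A) -> (M < (p + q) * (p + q))%N ->
  ((p + q) * (p * q) <= K)%N ->
  generating B -> fully_distributed q B -> good p q M.+1 (p * K) B.
Proof.
move=> p0 q1 co cl MN NK genB fq; have q0 := ltnW q1; have B0 := genB.1.
have co' : coprime q p by rewrite coprime_sym.
have cl' A : good q p M K A := goodC (cl A).
have MB : (M.+1 * #|` B| <= (p + q) * ((p + q) * #|` B|))%N.
  by rewrite mulnA leq_mul2r MN orbT.
have [fp|nfp] := classic (fully_distributed p B).
  have le1 : ((p + q) * ((p + q) * #|` B|)
      <= (p + q) * (#|` sd p q B B| + p * q))%N.
    by rewrite leq_mul2l card_sd_fully_distributed ?orbT.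
  apply: leq_trans MB (leq_trans le1 _); rewrite mulnDr leq_add2l.
  by rewrite (leq_trans NK) // leq_pmull.
(* For [p = 1] the element 0 alone makes [B] fully distributed modulo [p]. *)
have p1 : (1 < p)%N.
  case: p p0 nfp {co cl MN NK co' cl' MB} => [//|[|//]] _ [] t.
  by exists 0 => //; rewrite dvd1z.
have NK' : (q + p <= K)%N by nia.
have MN' : (M <= (q + p) * (q + p))%N by rewrite addnC ltnW.
apply: NNPP => ngood.
have large k b : b \in cls q k B -> (#|` B| < (p + q) * #|` cls q k B|)%N.
  move=> bk; rewrite ltnNge; apply/negP => small; apply: ngood.
  apply: good_weaken (good_small_class p0 q0 co cl (ltnW MN) bk small); nia.
(* If the piece misses the residue [t] modulo [q], then [q * y + p * cls q t B] is disjoint from the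
   sum of the piece with itself, and its size is a sufficient gain. *)
have fdq (j : 'I_p) y : y \in cls p j%:Z B -> fully_distributed q (cls p j%:Z B).
  move=> yj t; apply: NNPP => nt; apply/ngood/goodC.
  have [b0 b0B b0t] := fq t.
  have b0c : b0 \in cls q t B by rewrite mem_cls b0B.
  apply: (good_of_gain (i0 := j) (mu := #|` cls q t B|)) => //; last first.
    by rewrite addnC; apply: ltnW; apply: large b0c.
  have pn0 : p%:Z != 0 by lia.
  rewrite -(card_affine (q%:Z * y) (cls q t B) pn0).
  apply: leq_card_disjoint2; first by apply: sdS => //; exact: cls_sub.
    apply/fsubsetP=> _ /affineP[b bA ->]; apply: mem_sd => //.
    exact: (fsubsetP (cls_sub q t B)).
  move=> _ /sdP[y1 y1j [y2 y2j ->]]; apply/affineP => -[b].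
  rewrite mem_cls => /andP[_ bt] E; apply: nt; exists y2 => //.
  have -> : y2 - t = 1 * (y2 - b) + 1 * (b - t) by ring.
  apply: dvdz_lin => //; apply: (dvdz_cancel co); apply/dvdzP; exists (y - y1).
  lia.
have key (j : 'I_p) : ((p + q) * #|` cls p j%:Z B|
    <= #|` sd q p (cls p j%:Z B) B| + p * q)%N.
  have [->|/fset0Pn[y yj]] := eqVneq (cls p j%:Z B) fset0.
    by rewrite cardfs0 muln0.
  have [X XE] := cls_affine j%:Z B p0.
  have pn0 : p%:Z != 0 by lia.
  have [x xX yE] : exists2 x, x \in X & y = j%:Z + p%:Z * x.
    by apply/affineP; rewrite -XE.
  have [/goodC//|fpX] := good_or_fully_distributed q0 p1 co' cl' MN' NK' genB XE xX.
  have fqX : fully_distributed q X.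
    by have := fdq j y yj; rewrite XE; apply: fully_distributed_affine.
  apply: leq_trans (_ : #|` sd q p (cls p j%:Z B) (cls p j%:Z B)| + p * q <= _)%N.
    rewrite XE card_sd_affine // card_affine // sdC.
    exact: card_sd_fully_distributed.
  by rewrite leq_add2r fsubset_leq_card // sdS // cls_sub.
apply: ngood.
have : (\sum_(j < p) (p + q) * #|` cls p j%:Z B|
    <= \sum_(j < p) (#|` sd q p (cls p j%:Z B) B| + p * q))%N.
  by apply: leq_sum => j _; exact: key.
rewrite !big_split /= -big_distrr /= -card_cls // sum_nat_const card_ord => le1.
have le2 := leq_sum_sd_cls B B p0 co'.
have le3 : ((p + q) * #|` B| <= #|` sd p q B B| + p * (p * q))%N.
  by rewrite [sd p q B B]sdC (leq_trans le1) // leq_add2r.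
have le4 : ((p + q) * ((p + q) * #|` B|)
    <= (p + q) * (#|` sd p q B B| + p * (p * q)))%N by rewrite leq_mul2l le3 orbT.
apply: leq_trans MB (leq_trans le4 _); rewrite mulnDr leq_add2l.
by rewrite mulnCA leq_mul2l NK orbT.
Qed.

(** * One increment of the slope, the starting slope 3 and the iteration *)

Lemma card_fully_distributed q (X : {fset int}) : (1 < q)%N -> fully_distributed q X ->
  (1 < #|` X|)%N.
Proof.
move=> q1 fX; have [a aX a0] := fX 0; have [b bX b1] := fX 1.
rewrite (cardfsD1 a) aX ltnS cardfs_gt0; apply/fset0Pn; exists b.
rewrite !inE bX andbT; apply/eqP => ba.
have := dvdz_lin 1 (-1) a0 b1; rewrite ba (_ : _ + _ = 1); last by ring.
by rewrite dvdz1 /=; lia.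
Qed.

Lemma good_card1 p q M K (A : {fset int}) : (0 < p)%N -> (0 < q)%N -> (#|` A| <= 1)%N ->
  (M <= p + q + K)%N -> good p q M K A.
Proof.
move=> p0 q0 A1 MK; rewrite /good.
have [->|/fset0Pn[a aA]] := eqVneq A fset0; first by rewrite cardfs0 muln0.
have := card_sd_ge p0 q0 aA aA.
have : (0 < #|` A|)%N by rewrite cardfs_gt0; apply/fset0Pn; exists a.
move: #|` A| #|` sd p q A A| A1 => x y; nia.
Qed.

(** The factor [q] counts the classes of the normalised set, and [p] is the cost of
    [good_fully_distributed] on each of them. *)
Lemma good_step p q M K :
  (0 < p)%N -> (1 < q)%N -> coprime p q ->
  (M < (p + q) * (p + q))%N -> ((p + q) * (p * q) <= K)%N ->
  (forall A, good p q M K A) -> forall A, good p q M.+1 (p * q * K) A.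
Proof.
move=> p0 q1 co MN NK cl A; have q0 := ltnW q1.
have Npq : (p + q <= p * q + 1)%N by nia.
have [A1|A1] := leqP #|` A| 1.
  apply: good_card1 => //; apply: (leq_trans MN).
  apply: leq_trans (_ : (p + q) * (p * q + 1) <= _)%N.
    by rewrite leq_mul2l Npq orbT.
  by nia.
have [r [g [A' [g0 -> genA]]]] := exists_generating A1.
apply: good_affine => // {A A1 r g g0}; apply: NNPP => ngood.
have NK' : (p + q <= K)%N by nia.
have key (i : 'I_q) : (M.+1 * #|` cls q i%:Z A'|
    <= (p + q) * #|` sd p q (cls q i%:Z A') A'| + p * K)%N.
  have [->|/fset0Pn[y yi]] := eqVneq (cls q i%:Z A') fset0.
    by rewrite cardfs0 muln0.
  have [X XE] := cls_affine i%:Z A' q0.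
  have qn0 : q%:Z != 0 by lia.
  have [x xX yE] : exists2 x, x \in X & y = i%:Z + q%:Z * x.
    by apply/affineP; rewrite -XE.
  have [gA|fqX] := good_or_fully_distributed p0 q1 co cl (ltnW MN) NK' genA XE xX.
    by case: ngood; apply: good_weaken gA; nia.
  have : good p q M.+1 (p * K) (cls q i%:Z A').
    rewrite XE; apply: good_affine => //.
    (* [X] need not be generating, so it is normalised again; full distribution modulo [q] survives
       this. *)
    have [s [h [B [h0 BE genB]]]] := exists_generating (card_fully_distributed q1 fqX).
    rewrite BE; apply: good_affine => //; apply: good_fully_distributed => //.
    by apply: (@fully_distributed_affine q s h); rewrite -BE.
  rewrite /good => /leq_trans; apply; rewrite leq_add2r leq_mul2l.
  by rewrite fsubset_leq_card ?orbT // sdS // cls_sub.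
apply: ngood; rewrite /good; move: M.+1 key => M1 key.
have : (\sum_(i < q) M1 * #|` cls q i%:Z A'|
    <= \sum_(i < q) ((p + q) * #|` sd p q (cls q i%:Z A') A'| + p * K))%N.
  by apply: leq_sum => i _; exact: key.
rewrite big_split /= sum_nat_const card_ord -!big_distrr /= -card_cls // => le1.
have le2 : ((p + q) * (\sum_(i < q) #|` sd p q (cls q i%:Z A') A'|)
    <= (p + q) * #|` sd p q A' A'|)%N.
  by rewrite leq_mul2l leq_sum_sd_cls ?orbT.
move: (\sum_(i < q) _)%N #|` A'| le1 le2 => S a; move: #|` _| => f; lia.
Qed.

(** A generating set meets the class of 0 and another class modulo [q]. Each of these two
    contributes [#|] B| - 1[beyond its own size, so the total is at least]3 * #|[B| - 2], and 2 is
    at most [p * q]. *)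
Lemma card_sd_ge3 p q (A : {fset int}) : (0 < p)%N -> (1 < q)%N -> coprime p q ->
  (3 * #|` A| <= #|` sd p q A A| + p * q)%N.
Proof.
move=> p0 q1 co; have q0 := ltnW q1.
have [A1|A1] := leqP #|` A| 1.
  have [->|/fset0Pn[a aA]] := eqVneq A fset0; first by rewrite cardfs0 muln0.
  have := card_sd_ge p0 q0 aA aA.
  have : (0 < #|` A|)%N by rewrite cardfs_gt0; apply/fset0Pn; exists a.
  nia.
have [r [g [B [g0 -> [B0 genB]]]]] := exists_generating A1.
rewrite card_sd_affine // card_affine // {A A1 r g g0}.
have [b bB qb] : exists2 b, b \in B & ~~ (q%:Z %| b)%Z.
  apply: NNPP => nb; have : (q%:Z %| 1)%Z.
    apply: (genB (fun x => q%:Z %| x)%Z) => [|x y|b bB]; first exact: dvdz0.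
      exact: rpredB.
    by apply/negPn/negP => qb; apply: nb; exists b.
  by rewrite dvdz1 /=; lia.
have [i bi] := exists_residue b q0.
have Bgt0 : (0 < #|` B|)%N by rewrite cardfs_gt0; apply/fset0Pn; exists b.
have ci c (j : 'I_q) : c \in cls q j%:Z B ->
    (#|` cls q j%:Z B| + (#|` B| - 1) <= #|` sd p q (cls q j%:Z B) B|)%N.
  move=> cj; rewrite addnBA // leq_subLR [leqRHS]addnC.
  exact: (card_sd_ge p0 q0 cj (fsubsetP (cls_sub _ _ _) _ cj)).
have i0 : i != Ordinal q0.
  apply: contra qb => /eqP i0; move: bi; rewrite i0 /= subr0 //.
have key (j : 'I_q) : (#|` cls q j%:Z B| + (j == Ordinal q0) * (#|` B| - 1)
  + (j == i) * (#|` B| - 1) <= #|` sd p q (cls q j%:Z B) B|)%N.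
  have [->|j0] := eqVneq j (Ordinal q0).
    rewrite eq_sym (negbTE i0) mul1n addn0; apply: (ci 0).
    by rewrite mem_cls B0 subrr dvdz0.
  have [->|ji] := eqVneq j i.
    by rewrite mul1n addn0; apply: (ci b); rewrite mem_cls bB.
  have [->|/fset0Pn[c cj]] := eqVneq (cls q j%:Z B) fset0.
    by rewrite cardfs0.
  by rewrite !addn0; apply: leq_trans (ci c _ cj); rewrite leq_addr.
have := leq_trans (leq_sum _ (fun j _ => key j)) (leq_sum_sd_cls B B q0 co).
rewrite !big_split /= -card_cls // -!big_distrl /=.
have sum1 (k : 'I_q) : (\sum_(j < q) (j == k) = 1)%N.
  by rewrite (bigD1 k) //= eqxx big1 // => j /negbTE->.
rewrite !sum1; nia.
Qed.

(** The start [n = 0] is slope 3 with loss [p * q], scaled by [p + q]; this accounts for the [+ 1]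
    in the exponent. *)
Lemma good_iter p q n : (0 < p)%N -> (1 < q)%N -> coprime p q ->
  (3 * (p + q) + n <= (p + q) * (p + q))%N ->
  forall A, good p q (3 * (p + q) + n) ((p + q) * (p * q) ^ (n + 1)) A.
Proof.
move=> p0 q1 co; elim: n => [|n IH] nN A.
  by rewrite /good addn0 expn1; have := card_sd_ge3 A p0 q1 co; nia.
rewrite addnS; have -> : ((p + q) * (p * q) ^ (n.+1 + 1)
  = p * q * ((p + q) * (p * q) ^ (n + 1)))%N by rewrite addSn expnS; lia.
apply: good_step => //; first by rewrite -addnS.
  by rewrite leq_mul2l -{1}(expn1 (p * q)) leq_pexp2l ?orbT //; nia.
by apply: IH; apply: leq_trans nN; rewrite addnS.
Qed.

(* The exponent is in nat; since 1 <= p < q forces 3 <= p + q, the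
   truncated subtraction p + q - 3 is the genuine one. *)
Theorem theorem1p1 (p q : nat) (hp : (1 <= p)%N) (hpq : (p < q)%N)
    (hcop : coprime p q) (A : {fset int}) :
  (p%:Z + q%:Z) * #|` A|%:Z
    - (p%:Z * q%:Z) ^+ ((p + q - 3) * (p + q) + 1)%N
  <= #|` sumset (dilate p%:Z A) (dilate q%:Z A)|%:Z.
Proof.
have q1 : (1 < q)%N by lia.
(* This number of steps brings [M] to [(p + q) * (p + q)], so a factor [p + q] cancels from every
   term. *)
have eN : (3 * (p + q) + (p + q - 3) * (p + q) = (p + q) * (p + q))%N by nia.
have := good_iter (n := (p + q - 3) * (p + q)) hp q1 hcop _ A.
rewrite eN => /(_ (leqnn _)).
rewrite /good -mulnA -mulnDr leq_pmul2l; last by lia.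
rewrite -/(sd p q A A) -PoszM -rmorphXn /= natrXE.
by rewrite lerBlDr -!PoszD -PoszM lez_nat.
Qed.
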